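(* Let $X$ be a separable non-zero real Banach space. The following assertions are equivalent: (1) $X$ has the Daugavet property, that is, for every $x\in S_X$, every non-empty relatively weakly open subset $W$ of $B_X$ and every $\varepsilon>0$ there exists $y\in W$ such that $\|x+y\|>2-\varepsilon$. (2) For every non-empty relatively weakly-star open subset $W$ of $B_{X^{**}}$ there exists $u\in S_{X^{**}}\cap W$ such that $\|x+u\|=1+\|x\|$ holds for every $x\in X$.
   Context: All Banach spaces are real. $B_X$ and $S_X$ denote the closed unit ball and the unit sphere of $X$. $X$ is regarded as a subspace of $X^{**}$ via the canonical embedding, and the weak-star topology of $X^{**}$ is the one induced by $X^*$. A Banach space $X$ has the Daugavet property if every bounded rank-one operator $T:X\to X$ satisfies $\|T+I\|=1+\|T\|$, where $I$ is the identity operator; it is known that this is equivalent to the condition displayed in (1). *)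

(* Defs.v *)
From HB Require Import structures.
From mathcomp Require Import all_boot all_order all_algebra.
From mathcomp Require Import all_classical all_reals all_analysis.

Set Implicit Arguments.
Unset Strict Implicit.
Unset Printing Implicit Defensive.

Import Order.TTheory GRing.Theory Num.Theory.
Import numFieldNormedType.Exports.

Local Open Scope classical_set_scope.
Local Open Scope ring_scope.

Definition separable (T : topologicalType) : Prop :=
  exists2 D : set T, countable D & dense D.

Definition relatively_open (T : topologicalType) (B W : set T) : Prop :=
  exists2 O : set T, open O & W = B `&` O.

Definition unit_ball (R : realType) (V : normedModType R) : set V :=
  [set x | `|x| <= 1].

Definition unit_sphere (R : realType) (V : normedModType R) : set V :=
  [set x | `|x| = 1].

Arguments unit_ball {R} V.
Arguments unit_sphere {R} V.

Section dual.
Context {R : realType} (V : normedModType R).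

Definition cont_linear : {pred V -> R^o} :=
  mem [set f : V -> R^o | linear f /\ continuous f].

Structure dual : Type := Dual {
  dual_fun :> V -> R^o;
  dualP : dual_fun \in cont_linear
}.

HB.instance Definition _ := [isSub for dual_fun].
HB.instance Definition _ := [Choice of dual by <:].

Lemma cont_linear_submod_closed : submod_closed cont_linear.
Proof.
split=> [|a f g].
  rewrite inE; split; first by move=> a x y; rewrite /= scaler0 addr0.
  exact: cst_continuous.
rewrite !inE => -[fl fc] [gl gc]; split.
  move=> b x y; rewrite !fctE fl gl !scalerDr !scalerA (mulrC a b).
  by rewrite addrACA.
move=> x; apply: (@continuousD _ _ _ (fun x => a * f x)); last exact: gc.
by apply: continuousM; [exact: cst_continuous | exact: fc].
Qed.

HB.instance Definition _ :=
  GRing.isSubmodClosed.Build R (V -> R^o) cont_linear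
    cont_linear_submod_closed.
HB.instance Definition _ := [SubChoice_isSubLmodule of dual by <:].

Lemma dual_linear (f : dual) : linear f.
Proof. by have := dualP f; rewrite inE => -[]. Qed.

Lemma dual_continuous (f : dual) : continuous f.
Proof. by have := dualP f; rewrite inE => -[]. Qed.

HB.instance Definition _ (f : dual) :=
  GRing.isLinear.Build R V R^o *:%R f (dual_linear f).

Definition dual_norm (f : dual) : R := sup [set `|f x| | x in unit_ball V].

Lemma has_sup_dual_norm (f : dual) : has_sup [set `|f x| | x in unit_ball V].
Proof.
split; first by exists `|f 0|, 0 => //; rewrite /unit_ball /= normr0.
have /bounded_funP/(_ 1)[M fM] :=
  continuous_linear_bounded 0 (@dual_continuous f 0).
by exists M => _ [x x1 <-]; exact: fM.
Qed.

Lemma dual_norm_ub (f : dual) (x : V) : `|f x| <= dual_norm f * `|x|.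
Proof.
have [->|x0] := eqVneq x 0; first by rewrite linear0 !normr0 mulr0.
have nx0 : 0 < `|x| by rewrite normr_gt0.
rewrite -ler_pdivrMr// mulrC -[X in X * _]gtr0_norm ?invr_gt0// -normrM.
rewrite -[_ * f x]/(`|x|^-1 *: f x) -linearZ.
apply: (ub_le_sup (has_sup_dual_norm f).2); exists (`|x|^-1 *: x) => //.
by rewrite /unit_ball /= normrZ gtr0_norm ?invr_gt0// mulVf// gt_eqF.
Qed.

Lemma dual_norm_le (f : dual) (M : R) :
  (forall x, `|x| <= 1 -> `|f x| <= M) -> dual_norm f <= M.
Proof.
move=> fM; apply: (ge_sup (has_sup_dual_norm f).1) => _ [x x1 <-].
exact: fM.
Qed.

Lemma dual_norm_ge0 (f : dual) : 0 <= dual_norm f.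
Proof.
apply: (ub_le_sup (has_sup_dual_norm f).2); exists 0.
  by rewrite /unit_ball /= normr0.
by rewrite linear0 normr0.
Qed.

Lemma dual_ler_normD (f g : dual) :
  dual_norm (f + g) <= dual_norm f + dual_norm g.
Proof.
apply: dual_norm_le => x x1; apply: le_trans (ler_normD _ _) _.
by apply: lerD; apply: le_trans (dual_norm_ub _ _) _;
  apply: ler_piMr => //; exact: dual_norm_ge0.
Qed.

Let dual_normZ_le (a : R) (f : dual) :
  dual_norm (a *: f) <= `|a| * dual_norm f.
Proof.
apply: dual_norm_le => x x1; rewrite -[_ x]/(a * f x) normrM.
rewrite ler_wpM2l//; apply: le_trans (dual_norm_ub _ _) _.
by apply: ler_piMr => //; exact: dual_norm_ge0.
Qed.

Lemma dual_normZ (a : R) (f : dual) : dual_norm (a *: f) = `|a| * dual_norm f.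
Proof.
apply/eqP; rewrite eq_le dual_normZ_le /=.
have [->|a0] := eqVneq a 0; first by rewrite normr0 mul0r dual_norm_ge0.
rewrite -ler_pdivlMl ?normr_gt0// -normfV.
by rewrite -{1}[f]scale1r -(mulVf a0) -scalerA dual_normZ_le.
Qed.

Lemma dual_norm0_eq0 (f : dual) : dual_norm f = 0 -> f = 0.
Proof.
move=> f0; apply/val_inj/funext => x; apply/eqP.
by rewrite -normr_le0 (le_trans (dual_norm_ub f x))// f0 mul0r.
Qed.

HB.instance Definition _ := Lmodule_isNormed.Build R dual
  dual_ler_normD dual_normZ dual_norm0_eq0.

End dual.

Arguments cont_linear {R} V.

Section bidual.
Context {R : realType} (X : normedModType R).

Let evalP (x : X) : (fun f : dual X => f x) \in cont_linear (dual X).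
Proof.
have evL : linear (fun f : dual X => f x : R^o) by [].
pose ev : {linear dual X -> R^o} :=
  HB.pack (fun f : dual X => f x : R^o) (GRing.isLinear.Build _ _ _ _ _ evL).
rewrite inE; split; first exact: evL.
apply: (@bounded_linear_continuous _ _ _ ev).
apply/linear_boundedP; exists `|x|; split=> [|r xr f]; first exact: num_real.
rewrite /= mulrC; apply: (le_trans (dual_norm_ub f x)).
by apply: ler_wpM2l; [exact: dual_norm_ge0 | exact: ltW].
Qed.

Definition bidual_embed (x : X) : dual (dual X) := Dual (evalP x).

(* The coarsest topology on X making every f in the dual continuous. *)
Definition weak_topology : Type :=
  initial_topology (fun x : X => (fun f => f x) : {ptws dual X -> R^o}).

(* The coarsest topology on the dual of X making all evaluations continuous. *)
Definition weak_star_topology : Type :=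
  initial_topology (fun f : dual X => (f : X -> R^o) : {ptws X -> R^o}).

HB.instance Definition _ := Topological.on weak_topology.
HB.instance Definition _ := Topological.on weak_star_topology.

End bidual.

(* The geometric form of the Daugavet property, in terms of relatively weakly
   open subsets of the ball; it is known to be equivalent to the equation
   |I + T| = 1 + |T| for all bounded rank-one operators T. *)
Definition daugavet_property (R : realType) (X : completeNormedModType R) :=
  forall (x : X) (W : set X) (e : R),
    unit_sphere X x ->
    relatively_open (T := weak_topology X) (unit_ball X) W -> W !=set0 ->
    0 < e ->
    exists2 y, W y & 2 - e < `|x + y|.

(* Main.v *)
(** For (1) => (2), build decreasing weakly open sets [V n] meeting the ball of
    [X], starting inside the given weak-star open set (Goldstine). At stage [n]
    the Daugavet property yields [y] in the ball and [V n], and a norming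
    functional [f] of norm at most [1], with [f y > 1 + |x_n| - e_n - f x_n];
    intersect [V n] with this half-space. An ultrafilter limit [u] in the bidual
    of points [y_n] of [V n] inherits all these inequalities, so
    [|x_n + u| >= 1 + |x_n| - e_n], and density of the [x_n] gives (2). For
    (2) => (1), a functional almost attaining [|x + u| = 2] is combined with
    Goldstine's theorem to replace [u] by a point of the ball of [X]. *)
Require Import Defs.
From HB Require Import structures.
From mathcomp Require Import all_boot all_order all_algebra.
From mathcomp Require Import all_classical all_reals all_analysis.
From mathcomp Require Import ring lra.

Set Implicit Arguments.
Unset Strict Implicit.
Unset Printing Implicit Defensive.

Import Order.TTheory GRing.Theory Num.Theory.
Import numFieldNormedType.Exports.

Local Open Scope classical_set_scope.
Local Open Scope ring_scope.

(** * Basic neighbourhoods in initial topologies, for the weak and weak-star cases alike *)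

(** The sets containing a finite-coordinate tube around [F w] form a filter [G]. It converges to
    [F w] at each coordinate, so every pointwise neighbourhood of [F w] belongs to [G]. *)
Lemma initial_ptws_basic_nbhs (R : realType) (S : choiceType)
    (I : topologicalType) (F : S -> {ptws I -> R^o})
    (O : set (initial_topology F)) (w : S) :
  open O -> O w ->
  exists (L : seq I) (d : R), 0 < d /\
    forall z : S, (forall i, i \in L -> `|F z i - F w i| < d) -> O z.
Proof.
case=> A oA <- Aw.
pose G := [set B : set {ptws I -> R^o} | exists (L : seq I) (d : R), 0 < d /\
  forall h : {ptws I -> R^o},
    (forall i, i \in L -> `|h i - F w i| < d) -> B h].
have GF : Filter G.
  split.
  - by exists [::], 1.
  - move=> B C [L [d [d0 LB]]] [L' [d' [d'0 LC]]].
    exists (L ++ L'), (Num.min d d'); split; first by rewrite lt_min d0.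
    move=> h hLL; split; [apply: LB|apply: LC] => i iL;
      by have := hLL i; rewrite mem_cat iL ?orbT lt_min => /(_ isT)/andP[].
  - by move=> B C BC [L [d [d0 LB]]]; exists L, d; split=> // h /LB/BC.
have Gw : {ptws, G --> F w}.
  apply/pointwise_cvgP => t; apply/cvgrPdist_lt => e e0.
  exists [:: t], e; split => // h; rewrite /= distrC; apply.
  by rewrite inE.
have [L [d [d0 LA]]] : G A by apply: Gw; exact: open_nbhs_nbhs.
by exists L, d; split => // z /LA.
Qed.

Lemma initial_ptws_open (R : realType) (S : choiceType) (I : eqType)
    (F : S -> {ptws I -> R^o}) (i : I) (B : set R) :
  open B -> open ([set z | B (F z i)] : set (initial_topology F)).
Proof.
move=> oB.
have cFi : continuous (proj i \o F : initial_topology F -> R^o).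
  move=> x; apply: (@continuous_comp (initial_topology F) _ _ F (proj i)).
    exact: (@initial_continuous _ _ F).
  exact: proj_continuous.
rewrite -[X in open X]/((proj i \o F : initial_topology F -> R^o) @^-1` B).
by apply: open_comp => // x _; exact: cFi.
Qed.

(** The centre [c] is arbitrary, so that an element of the bidual can be the centre of a weakly open
    subset of [X]. *)
Lemma initial_ptws_open_near (R : realType) (S : choiceType) (I : eqType)
    (F : S -> {ptws I -> R^o}) (L : seq I) (c : I -> R) (d : R) :
  open ([set z | forall i, i \in L -> `|F z i - c i| < d]
    : set (initial_topology F)).
Proof.
elim: L => [|i L IH].
  rewrite [X in open X](_ : _ = setT); first exact: openT.
  by apply/seteqP; split.
rewrite [X in open X](_ : _ = [set z | ball (c i) d (F z i)] `&`
    [set z | forall j, j \in L -> `|F z j - c j| < d]).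
  by apply: openI IH; apply: initial_ptws_open; exact: ball_open.
apply/seteqP; split => z /=.
  move=> h; split; first by rewrite /ball/= distrC h// mem_head.
  by move=> j jL; apply: h; rewrite in_cons jL orbT.
move=> [h1 h2] j; rewrite in_cons => /orP[/eqP->|/h2//].
by move: h1; rewrite /ball/= distrC.
Qed.

(** * Norm bounds for functionals *)

Lemma bounded_linear_dual (R : realType) (V : normedModType R) (l : V -> R^o)
    (M : R) :
  0 <= M -> linear l -> (forall x, `|l x| <= M * `|x|) ->
  exists2 f : dual V, f = l :> (V -> R^o) & `|f| <= M.
Proof.
move=> M0 ll lM.
pose l' : {linear V -> R^o} := HB.pack l (GRing.isLinear.Build _ _ _ _ _ ll).
have lP : l \in cont_linear V.
  rewrite inE; split => //; apply: (@bounded_linear_continuous _ _ _ l').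
  apply/linear_boundedP; exists M; split=> [|r xr f]; first exact: num_real.
  by apply: (le_trans (lM f)); apply: ler_wpM2r => //; exact: ltW.
exists (Dual lP) => //; apply: dual_norm_le => x x1.
by apply: (le_trans (lM x)); exact: ler_piMr.
Qed.

Lemma dual_unit_le (R : realType) (V : normedModType R) (f : dual V) (v : V) :
  `|f| <= 1 -> f v <= `|v|.
Proof.
move=> f1; apply: le_trans (ler_norm _) _.
by apply: le_trans (dual_norm_ub f v) _; exact: ler_piMl.
Qed.

Lemma dual_le_norm (R : realType) (V : normedModType R) (f : dual V) (v : V) :
  `|v| <= 1 -> f v <= `|f|.
Proof.
move=> v1; apply: le_trans (ler_norm _) _.
apply: le_trans (dual_norm_ub f v) _.
by apply: ler_piMr => //; exact: dual_norm_ge0.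
Qed.

Lemma bidual_embed_norm_le (R : realType) (X : normedModType R) (x : X) :
  `|bidual_embed x| <= `|x|.
Proof.
apply: dual_norm_le => f f1; apply: le_trans (dual_norm_ub f x) _.
exact: ler_piMl.
Qed.

(** * Norming functionals from minimal sublinear functionals *)

Section hahn_banach.
Context {R : realType} (V : normedModType R).
Implicit Types (p q : V -> R) (a x y : V).

Definition sublinear p :=
  (forall x y, p (x + y) <= p x + p y) /\
  (forall (c : R) x, 0 <= c -> p (c *: x) <= c * p x).

Lemma sublinear0 p : sublinear p -> p 0 = 0.
Proof.
move=> [pD pZ]; apply/eqP; rewrite eq_le; apply/andP; split.
  by have := pZ 0 0 (lexx _); rewrite scale0r mul0r.
by have := pD 0 0; rewrite addr0; lra.
Qed.

Lemma sublinearN p x : sublinear p -> - p (- x) <= p x.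
Proof.
by move=> sp; have := sp.1 x (- x); rewrite subrr sublinear0//; lra.
Qed.

Lemma sublinear_norm : sublinear (fun x => `|x|).
Proof.
split=> [x y|c x c0]; first exact: ler_normD.
by rewrite normrZ ger0_norm.
Qed.

(** Serves both [push_down] and infima of chains: for sums, [k] is the sum of the parameters in the
    first case and the smaller functional in the second. The minorant [m] keeps the infimum
    finite. *)
Lemma sublinear_inf (I : Type) (A : set I) (F : I -> V -> R) (m : V -> R) :
  A !=set0 -> (forall i x, A i -> m x <= F i x) ->
  (forall i j x y, A i -> A j ->
     exists2 k, A k & F k (x + y) <= F i x + F j y) ->
  (forall i (c : R) x, A i -> 0 < c ->
     exists2 k, A k & F k (c *: x) <= c * F i x) ->
  (exists2 i, A i & F i 0 <= 0) ->
  sublinear (fun x => inf [set F i x | i in A]).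
Proof.
move=> [i0 Ai0] mF FD FZ [i1 Ai1 Fi1].
have ne x : [set F i x | i in A] !=set0 by exists (F i0 x), i0.
have lb x : has_lbound [set F i x | i in A].
  by exists (m x) => _ [i Ai <-]; exact: mF.
have infle x i : A i -> inf [set F i x | i in A] <= F i x.
  by move=> Ai; apply: ge_inf => //; exists i.
split=> [x y|c x].
  rewrite -lerBlDr; apply: lb_le_inf => // _ [i Ai <-].
  rewrite lerBlDr -lerBlDl; apply: lb_le_inf => // _ [j Aj <-].
  rewrite lerBlDl; have [k Ak] := FD i j x y Ai Aj.
  by apply: le_trans; exact: infle.
rewrite le_eqVlt => /orP[/eqP<-|c0].
  by rewrite scale0r mul0r; apply: le_trans Fi1; exact: infle.
rewrite mulrC -ler_pdivrMr//; apply: lb_le_inf => // _ [i Ai <-].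
rewrite ler_pdivrMr// mulrC; have [k Ak] := FZ i c x Ai c0.
by apply: le_trans; exact: infle.
Qed.

(** For sublinear [p], this is the largest sublinear functional below [p] whose value at [- a] is at
    most [- p a]. *)
Definition push_down p a x :=
  inf [set p (x + t *: a) - t * p a | t in [set t | 0 <= t]].

Lemma push_down_lb p a x (t : R) : sublinear p -> 0 <= t ->
  - p (- x) <= p (x + t *: a) - t * p a.
Proof.
move=> sp t0.
have h : t * p a <= p (t *: a).
  move: t0; rewrite le_eqVlt => /orP[/eqP<-|t0].
    by rewrite mul0r scale0r sublinear0.
  rewrite mulrC -ler_pdivlMr// mulrC.
  have := sp.2 t^-1 (t *: a); rewrite scalerA mulVf ?gt_eqF// scale1r; apply.
  by rewrite invr_ge0 ltW.
have := sp.1 (x + t *: a) (- x).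
by rewrite (addrC x) addrK; lra.
Qed.

Lemma push_down_le p a x (t : R) : sublinear p -> 0 <= t ->
  push_down p a x <= p (x + t *: a) - t * p a.
Proof.
move=> sp t0; apply: ge_inf; last by exists t.
by exists (- p (- x)) => _ [s s0 <-]; exact: push_down_lb.
Qed.

Lemma push_down_sublinear p a : sublinear p -> sublinear (push_down p a).
Proof.
move=> sp; apply: (@sublinear_inf _ _ _ (fun x => - p (- x))).
- by exists 0 => /=.
- by move=> t x t0; exact: push_down_lb.
- move=> s t x y s0 t0; exists (s + t); first exact: addr_ge0.
  have := sp.1 (x + s *: a) (y + t *: a).
  by rewrite addrACA -scalerDl; lra.
- move=> t c x t0 c0; exists (c * t); first by apply: mulr_ge0 => //; exact: ltW.
  have := sp.2 c (x + t *: a) (ltW c0).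
  by rewrite scalerDr scalerA; lra.
- by exists 0 => /=; rewrite // scale0r addr0 sublinear0// mul0r subr0.
Qed.

(* A minimal [p] equals each of its [push_down p a], which at [t = 1] reads
   [p x + p a <= p (x + a)]. *)
Lemma minimal_sublinear_linear p : sublinear p ->
  (forall q, sublinear q -> (forall x, q x <= p x) -> q = p) ->
  linear (p : V -> R^o).
Proof.
move=> sp pmin.
have pD x y : p (x + y) = p x + p y.
  apply/eqP; rewrite eq_le sp.1 /=.
  have <- : push_down p y x = p x.
    rewrite (pmin (push_down p y))//; first exact: push_down_sublinear.
    move=> z; have := @push_down_le p y z 0 sp (lexx _).
    by rewrite scale0r addr0 mul0r subr0.
  by have := @push_down_le p y x 1 sp ler01; rewrite scale1r; lra.
have pN x : p (- x) = - p x.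
  by apply/eqP; rewrite eq_sym -subr_eq0 -opprD oppr_eq0 -pD subrr sublinear0.
have pZ c x : 0 <= c -> p (c *: x) = c * p x.
  move=> c0; apply/eqP; rewrite eq_le sp.2//=.
  by have := sp.2 c (- x) c0; rewrite scalerN !pN; lra.
move=> c x y; rewrite pD; congr (_ + _); rewrite -[RHS]/(c * p x).
have [c0|c0] := leP 0 c; first exact: pZ.
by rewrite -[c]opprK scaleNr pN pZ ?mulNr// oppr_ge0 ltW.
Qed.

(** Zorn's lemma for the reversed pointwise order. The infimum of a chain is finite because each
    sublinear [q] below [p] satisfies [- p (- x) <= q x]. *)
Lemma exists_minimal_sublinear p : sublinear p ->
  exists q, [/\ sublinear q, forall x, q x <= p x &
    forall r, sublinear r -> (forall x, r x <= q x) -> r = q].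
Proof.
move=> sp.
pose P q := sublinear q /\ forall x, q x <= p x.
pose T := {q : V -> R | P q}.
pose below (q r : T) := `[< forall x, sval r x <= sval q x >].
have [||||[q [sq qp]] qmin] := @Zorn T below.
- by move=> q; apply/asboolP.
- move=> q r s /asboolP rq /asboolP sr; apply/asboolP => x.
  exact: le_trans (sr x) (rq x).
- move=> [q qP] [r rP] /asboolP/= rq /asboolP/= qr.
  have qrE : q = r by apply/funext => x; apply/eqP; rewrite eq_le rq qr.
  by case: _ / qrE rP {rq qr} => rP; congr exist; exact: Prop_irrelevance.
- move=> A Atot; have [[q0 Aq0]|A0] := pselect (A !=set0); last first.
    by exists (exist P p (conj sp (fun=> lexx _))) => q Aq; case: A0; exists q.
  have lbA (q : T) x : A q -> - p (- x) <= sval q x.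
    move=> Aq; have [sq qp] := svalP q.
    by apply: le_trans (sublinearN x sq); rewrite lerN2.
  have sinf : sublinear (fun x => inf [set sval q x | q in A]).
    apply: (@sublinear_inf _ _ _ (fun x => - p (- x))) => //.
    - by exists q0.
    - move=> q r x y Aq Ar; have [[qD _] _] := svalP q.
      have [[rD _] _] := svalP r.
      have [/asboolP rq|/asboolP qr] := Atot q r Aq Ar.
        by exists r => //; apply: le_trans (rD x y) _; rewrite lerD2r.
      by exists q => //; apply: le_trans (qD x y) _; rewrite lerD2l.
    - move=> q c x Aq c0; exists q => //.
      by have [[_ qZ] _] := svalP q; apply: qZ; exact: ltW.
    - by exists q0 => //; have [sq _] := svalP q0; rewrite sublinear0.
  have infle (q : T) x : A q -> inf [set sval q x | q in A] <= sval q x.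
    move=> Aq; apply: ge_inf; last by exists q.
    by exists (- p (- x)) => _ [r Ar <-]; exact: lbA.
  have infp x : inf [set sval q x | q in A] <= p x.
    by apply: le_trans (infle q0 x Aq0) _; have [_] := svalP q0.
  exists (exist P _ (conj sinf infp)) => q Aq; apply/asboolP => x /=.
  exact: infle.
exists q; split=> // r sr rq.
have rp x : r x <= p x by apply: le_trans (rq x) (qp x).
by have /(congr1 sval) := qmin (exist P r (conj sr rp)) (asboolT rq).
Qed.

(* Starting below [push_down |.| a] forces [f (- a) <= - |a|]. *)
Lemma norming_functional a : exists2 f : dual V, `|f| <= 1 & f a = `|a|.
Proof.
have sN := sublinear_norm.
have [q [sq qle qmin]] := exists_minimal_sublinear (push_down_sublinear a sN).
have qN x : q x <= `|x|.
  apply: (le_trans (qle x)); have := @push_down_le _ a x 0 sN (lexx _).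
  by rewrite scale0r addr0 mul0r subr0.
have ql := minimal_sublinear_linear sq qmin.
pose q' : {linear V -> R^o} := HB.pack (q : V -> R^o)
  (GRing.isLinear.Build _ _ _ _ _ ql).
have qNE x : q (- x) = - q x by exact: (linearN q').
have [f fq f1] : exists2 f : dual V, f = q :> (V -> R^o) & `|f| <= 1.
  apply: bounded_linear_dual => // x.
  by rewrite mul1r ler_norml qN andbT lerNl -qNE (le_trans (qN _))// normrN.
exists f => //; rewrite fq; apply/eqP; rewrite eq_le qN /=.
have := le_trans (qle (- a)) (@push_down_le _ a (- a) 1 sN ler01).
by rewrite scale1r addNr normr0 qNE; lra.
Qed.

End hahn_banach.

(** * Goldstine's theorem by least squares *)

Lemma dual_lincomb (R : realType) (X : normedModType R) (I : Type) (s : seq I)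
    (a : I -> R) (g : I -> dual X) (y : X) :
  (\sum_(i <- s) a i *: g i) y = \sum_(i <- s) a i * g i y.
Proof.
elim: s => [|i s IH]; first by rewrite !big_nil.
by rewrite !big_cons -IH.
Qed.

(* An almost minimiser [y] of the squared distance to the target over the ball
   makes [h = sum_g (w g - g y) g] almost attain its norm at [y]; since
   [w h <= |h|], this forces [w h - h y], which is that squared distance, to be
   small. No compactness is needed. *)
Lemma goldstine (R : realType) (X : normedModType R) (w : dual (dual X))
    (L : seq (dual X)) (d : R) :
  `|w| <= 1 -> 0 < d ->
  exists2 y : X, `|y| <= 1 & forall g, g \in L -> `|g y - w g| < d.
Proof.
move=> w1 d0; pose Q (y : X) : R := \sum_(g <- L) (w g - g y) ^+ 2.
have Q0 y : 0 <= Q y by apply: sumr_ge0 => g _; exact: sqr_ge0.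
have [[y y1 Qy]|noy] := pselect (exists2 y : X, `|y| <= 1 & Q y < d ^+ 2).
  exists y => // g gL; rewrite distrC -(@ltr_pXn2r _ 2)// ?nnegrE ?normr_ge0// ?ltW//.
  rewrite real_normK ?num_real//; apply: le_lt_trans Qy.
  rewrite /Q (big_rem g)//= lerDl; apply: sumr_ge0 => h _; exact: sqr_ge0.
have Qd y : `|y| <= 1 -> d ^+ 2 <= Q y.
  by move=> y1; rewrite leNgt; apply/negP => Qy; apply: noy; exists y.
pose E : set R := [set Q y | y in unit_ball X].
have E0 : E !=set0 by exists (Q 0), 0 => //; rewrite /unit_ball /= normr0.
have Elb : has_lbound E by exists 0 => _ [y _ <-].
pose D := inf E.
have D0 : 0 < D.
  apply: (@lt_le_trans _ _ (d ^+ 2)); first exact: exprn_gt0.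
  by apply: lb_le_inf => // _ [y y1 <-]; exact: Qd.
pose M : R := \sum_(g <- L) (2 * `|g|) ^+ 2.
have M0 : 0 <= M by apply: sumr_ge0 => g _; exact: sqr_ge0.
(* The argument ends with [D <= Q y <= t * (M + 1) / 2], which this choice of [t] contradicts. *)
have [t [t0 t1 tM]] : exists t : R, [/\ 0 < t, t < 1 & t * (M + 1) < D].
  have DM : 0 < D + M + 1 by lra.
  exists (D / (D + M + 1)); rewrite divr_gt0// ltr_pdivrMr// mulrAC.
  by rewrite ltr_pdivrMr// ltr_pM2l//; split => //; lra.
(* The tolerance is quadratic in [t] because the comparison with [Q v] is later divided by [t]. *)
have [_ [y y1 <-] QyD] : exists2 e, E e & e < D + t ^+ 2.
  by apply: inf_adherent; [exact: exprn_gt0|split].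
have DQ z : `|z| <= 1 -> D <= Q z by move=> z1; apply: ge_inf => //; exists z.
pose h : dual X := \sum_(g <- L) (w g - g y) *: g.
have hE z : h z = \sum_(g <- L) (w g - g y) * g z by exact: dual_lincomb.
have wh : (w h : R) = \sum_(g <- L) (w g - g y) * w g.
  by rewrite /h linear_sum; apply: eq_bigr => g _; rewrite linearZ.
have hz z : `|z| <= 1 -> h z <= (h y : R) + t * (M + 1) / 2.
  (* A step from [y] towards [z] stays in the ball and changes [Q] to first order by
     [- 2 * t * (h z - h y)]. *)
  move=> z1; pose v := y + t *: (z - y).
  have v1 : `|v| <= 1.
    rewrite /v scalerBr addrCA -{1}[y]scale1r -scalerBl.
    apply: le_trans (ler_normD _ _) _; rewrite !normrZ.
    rewrite (gtr0_norm t0) gtr0_norm ?subr_gt0//.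
    have : t * `|z| <= t * 1 by rewrite ler_wpM2l// ltW.
    have : (1 - t) * `|y| <= (1 - t) * 1 by rewrite ler_wpM2l// subr_ge0 ltW.
    lra.
  have Qv : Q v = Q y - 2 * t * (h z - h y) +
      t ^+ 2 * \sum_(g <- L) (g z - g y) ^+ 2.
    rewrite !hE -sumrB !mulr_sumr /Q -sumrB -big_split /=.
    apply: eq_bigr => g _.
    rewrite /v linearD linearZ linearB /= -[_ *: _]/(t * (g z - g y)).
    ring.
  have SM : \sum_(g <- L) (g z - g y) ^+ 2 <= M.
    apply: ler_sum => g _; rewrite -[leLHS]real_normK ?num_real//.
    apply: lerXn2r; rewrite ?nnegrE ?mulr_ge0 ?normr_ge0//.
    apply: le_trans (ler_normB _ _) _.
    have gle x : `|x| <= 1 -> `|g x| <= `|g|.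
      move=> x1; apply: le_trans (dual_norm_ub g x) _.
      by apply: ler_piMr => //; exact: dual_norm_ge0.
    by have := gle z z1; have := gle y y1; lra.
  have : t ^+ 2 * \sum_(g <- L) (g z - g y) ^+ 2 <= t ^+ 2 * M.
    by rewrite ler_wpM2l// sqr_ge0.
  have := DQ v v1; rewrite Qv => h1 h2.
  have h3 : t * (2 * (h z - h y)) <= t * (t * (M + 1)) by lra.
  by move: h3; rewrite ler_pM2l//; lra.
have hle : `|h| <= (h y : R) + t * (M + 1) / 2.
  apply: dual_norm_le => z z1; rewrite ler_norml hz// andbT lerNl.
  by rewrite -[leLHS](linearN h) hz// normrN.
have whle : (w h : R) <= `|h| by exact: dual_unit_le.
have QyE : Q y = (w h : R) - (h y : R).
  rewrite wh hE -sumrB; apply: eq_bigr => g _; ring.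
by have := DQ y y1; rewrite QyE; lra.
Qed.

(** * Ultrafilter limits in the bidual *)

Section ultrafilter_limit.
Context {R : realType} (U : set_system nat) {UU : UltraFilter U}.

(** Compactness of [[- M, M]] gives a cluster point, and a cluster point of an ultrafilter is a
    limit. *)
Lemma bounded_ultra_cvg (s : nat -> R) (M : R) :
  (forall n, `|s n| <= M) -> exists l : R, s n @[n --> U] --> l.
Proof.
move=> sM.
have Us : U (s @^-1` [set` `[- M, M]]).
  by apply: filterE => n /=; rewrite in_itv /= -ler_norml sM.
have [l [_ /= cl]] := @segment_compact R (- M) M _ (fmap_proper_filter _ _) Us.
exists l => A /= lA; have [//|UA] := in_ultra_setVsetC (s @^-1` A) UU.
have [r [rA Ar]] := cl (~` A) A UA lA.
by case: rA.
Qed.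

(** The limits of [f (y n)] along [U] are linear in [f] and bounded by the norm of [f], so they
    define [u]. *)
Lemma bidual_ultralimit (X : normedModType R) (y : nat -> X) :
  (forall n, `|y n| <= 1) ->
  exists2 u : dual (dual X), `|u| <= 1 &
    forall (f : dual X) (a : R), (\forall n \near U, a <= f (y n)) -> a <= u f.
Proof.
move=> y1.
have fy (f : dual X) n : `|f (y n)| <= `|f|.
  apply: le_trans (dual_norm_ub f (y n)) _.
  by apply: ler_piMr => //; exact: dual_norm_ge0.
have [l lP] := choice (fun f : dual X => bounded_ultra_cvg (fy f)).
have Rh := @norm_hausdorff R R^o.
have ll : linear (l : dual X -> R^o).
  move=> a f g; apply: (cvg_unique Rh (lP (a *: f + g))).
  by apply: (@cvgD _ R^o); [apply: cvgM; [exact: cvg_cst|]|]; exact: lP.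
have lN f : `|l f| <= 1 * `|f|.
  rewrite mul1r; have cl := lP f; have/cvg_lim <- // := cl.
  rewrite ler_norml; apply/andP; split.
  - apply: limr_ge; first by apply/cvg_ex; exists (l f).
    by near=> n; have := fy f n; rewrite ler_norml => /andP[].
  - apply: limr_le; first by apply/cvg_ex; exists (l f).
    by near=> n; have := fy f n; rewrite ler_norml => /andP[].
have [u ul u1] := bounded_linear_dual ler01 ll lN.
exists u => // f a af; rewrite ul; have/cvg_lim <- // := lP f.
by apply: limr_ge => //; apply/cvg_ex; exists (l f); exact: lP.
Unshelve. all: by end_near.
Qed.

End ultrafilter_limit.

(** * The Daugavet property and norm additivity in the bidual *)

Lemma dual_norm_adherent (R : realType) (V : normedModType R) (f : dual V)
    (e : R) :
  0 < e -> exists2 v : V, `|v| <= 1 & `|f| - e < f v.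
Proof.
move=> e0.
have [_ [v v1 <-] fv] := sup_adherent e0 (has_sup_dual_norm f).
have [f0|f0] := leP 0 (f v).
  by exists v => //; rewrite -[ltRHS]ger0_norm.
by exists (- v); rewrite ?normrN// linearN -[ltRHS]ltr0_norm.
Qed.

Section daugavet.
Context {R : realType} (X : completeNormedModType R).

(* If [f] of norm at most [1] almost attains [|s + y| > 2 - e], with [s] and [y]
   in the ball, then both [f s] and [f y] are almost [1]; hence [f] also
   witnesses the estimate for every multiple [x = |x| s]. *)
Lemma daugavet_functional (x : X) (O : set (weak_topology X)) (e : R) :
  (exists z : X, z != 0) -> daugavet_property X -> open O ->
  (exists2 y : X, `|y| <= 1 & O y) -> 0 < e ->
  exists f : dual X, exists y : X,
    [/\ `|f| <= 1, `|y| <= 1, O y & 1 + `|x| - e - f x < f y].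
Proof.
move=> [x0 x00] dX oO [y0 y01 Oy0] e0.
(* For [x = 0] any unit vector serves as [s], and [x0] provides one. *)
have [s s1 xs] : exists2 s : X, `|s| = 1 & x = `|x| *: s.
  have unit (z : X) : z != 0 -> `| `|z|^-1 *: z| = 1.
    by move=> z0; rewrite normrZ ger0_norm ?invr_ge0// mulVf// normr_eq0.
  have [->|xn0] := eqVneq x 0.
    by exists (`|x0|^-1 *: x0); [exact: unit|rewrite normr0 scale0r].
  exists (`|x|^-1 *: x); first exact: unit.
  by rewrite scalerA mulfV ?scale1r// normr_eq0.
have x1 : 0 < 1 + `|x| by rewrite ltr_pwDl.
have W0 : unit_ball X `&` O !=set0 by exists y0.
have oW : relatively_open (T := weak_topology X) (unit_ball X)
    (unit_ball X `&` O) by exists O.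
(* With [d = e / (1 + |x|)], the loss [d] in [f y] and the loss [|x| * d] in [f x] add up to [e]. *)
have [y [y1 Oy] sy] := dX _ _ _ s1 oW W0 (divr_gt0 e0 x1).
have [f f1 fsy] := norming_functional (s + y).
exists f, y; split => //.
have fx : (f x : R) = `|x| * (f s : R) by rewrite {1}xs linearZ.
have fD : f (s + y) = (f s : R) + (f y : R) by rewrite linearD.
have fs1 : f s <= 1 by rewrite -s1; exact: dual_unit_le.
have fy1 : f y <= 1 by exact: le_trans (dual_unit_le _ f1) y1.
set d := e / (1 + `|x|) in sy.
have de : d * (1 + `|x|) = e by rewrite divfK// gt_eqF.
have fsd : 1 - d <= f s by lra.
have fyd : 1 - d < f y by lra.
rewrite fx; have : `|x| * (1 - d) <= `|x| * f s by rewrite ler_wpM2l.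
by rewrite -de; lra.
Qed.

Hypothesis (X_separable : separable X) (X_neq0 : exists x : X, x != 0).

Lemma daugavet_norm_additive (W : set (dual (dual X))) :
  daugavet_property X ->
  relatively_open (T := weak_star_topology (dual X))
    (unit_ball (dual (dual X))) W ->
  W !=set0 ->
  exists2 u : dual (dual X), (unit_sphere (dual (dual X)) `&` W) u &
    forall x : X, `|bidual_embed x + u| = 1 + `|x|.
Proof.
move=> dX [A oA ->] [w [w1 Aw]].
have [L [d [d0 LA]]] := initial_ptws_basic_nbhs oA Aw.
have [D Dc Ddense] := X_separable.
have [pts ptsD] : exists pts : nat -> X, D `<=` range pts.
  have /pfcard_geP[D0|[g]] := Dc; last first.
    by exists g; exact: (@surj _ _ _ _ g).
  by exists (fun=> 0); rewrite D0.
(* Every pair (dense point, tolerance 1 / (m + 1)) is [(pt n, ep n)] for some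
   stage [n]. *)
pose pt n : X := pts (odflt (0, 0)%N (unpickle n)).1.
pose ep n : R := ((odflt (0, 0)%N (unpickle n)).2.+1%:R)^-1.
have ep0 n : 0 < ep n by rewrite invr_gt0.
(* Here [f] precedes the conditions on [nO.2], so that choice gives a total [F]; its value is [0]
   where they fail. *)
have step (nO : nat * set (weak_topology X)) : exists f : dual X,
    open nO.2 -> (exists2 y : X, `|y| <= 1 & nO.2 y) ->
    exists y : X, [/\ `|f| <= 1, `|y| <= 1, nO.2 y &
      1 + `|pt nO.1| - ep nO.1 - f (pt nO.1) < f y].
  have [[oV neV]|noV] :=
      pselect (open nO.2 /\ exists2 y : X, `|y| <= 1 & nO.2 y).
    have [f fP] := daugavet_functional (pt nO.1) X_neq0 dX oV neV (ep0 nO.1).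
    by exists f.
  by exists 0 => oV neV; case: noV.
have [F FP] := choice step.
(* The radius [d / 2] in [V 0] leaves room for strict inequalities becoming weak in the limit. *)
pose V := fix V n : set (weak_topology X) := if n is m.+1 then
  V m `&` [set z : X | 1 + `|pt m| - ep m - F (m, V m) (pt m) < F (m, V m) z]
  else [set z : X | forall g, g \in L -> `|g z - w g| < d / 2].
have VP n : open (V n) /\ exists2 y : X, `|y| <= 1 & V n y.
  elim: n => [|n [oV neV]].
    split; last by apply: goldstine => //; rewrite divr_gt0.
    exact: (@initial_ptws_open_near _ _ _ (fun x : X => (fun f : dual X => f x))).
  split.
    apply: openI => //.
    apply: (@initial_ptws_open _ _ _ (fun x : X => (fun f : dual X => f x))
      (F (n, V n)) [set r | 1 + `|pt n| - ep n - F (n, V n) (pt n) < r]).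
    exact: open_gt.
  by have [y [_ y1 Vy Fy]] := FP (n, V n) oV neV; exists y.
have Vdecr n m : (n <= m)%N -> V m `<=` V n.
  elim: m => [|m IH]; first by rewrite leqn0 => /eqP->.
  rewrite leq_eqVlt => /orP[/eqP->//|]; rewrite ltnS => /IH VmVn z [Vz _].
  exact: VmVn.
have [y yP] := choice (fun n => let: conj _ (ex_intro2 y y1 Vy) := VP n in
  ex_intro (fun y : X => `|y| <= 1 /\ V n y) y (conj y1 Vy)).
have [U [UU ooU]] := @ultraFilterLemma _ \oo _.
have [u u1 uP] := bidual_ultralimit (U := U) (fun n => (yP n).1).
(* As [V] decreases, a bound valid on [V n] holds at [y m] for all [m >= n], hence along [U]. *)
have uV n (f : dual X) (a : R) : (forall z, V n z -> a <= f z) -> a <= u f.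
  move=> aV; apply: uP; apply: ooU; exists n => // m /= nm.
  by apply: aV; apply: Vdecr nm _ _; exact: (yP m).2.
have Au : A u.
  apply: LA => g gL; apply: (@le_lt_trans _ _ (d / 2)); last by lra.
  have ug : (w g : R) - d / 2 <= u g.
    apply: (uV 0%N) => z /(_ g gL); rewrite ltr_norml => /andP[+ _].
    by rewrite ltrBrDl => /ltW.
  (* [uV] transfers lower bounds only; the upper bound on [u g] comes from [- g]. *)
  have ugN : - ((w g : R) + d / 2) <= u (- g).
    apply: (uV 0%N) => z /(_ g gL); rewrite ltr_norml => /andP[_].
    by rewrite ltrBlDr addrC -[_ (- g) z]/(- (g z : R)) lerN2 => /ltW.
  move: ugN; rewrite [u (- g)]linearN lerN2 => ugN.
  by rewrite ler_norml; apply/andP; split; lra.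
have ptu n : 1 + `|pt n| - ep n <= `|bidual_embed (pt n) + u|.
  pose f := F (n, V n).
  have f1 : `|f| <= 1.
    by have [oV neV] := VP n; have [y' []] := FP (n, V n) oV neV.
  (* The half-space of stage [n] first enters at [V n.+1]. *)
  have uf : 1 + `|pt n| - ep n - (f (pt n) : R) <= u f.
    by apply: (uV n.+1) => z [_ /ltW].
  apply: le_trans (dual_le_norm (bidual_embed (pt n) + u) f1).
  by rewrite -[leRHS]/((f (pt n) : R) + (u f : R)); lra.
have uge x : 1 + `|x| <= `|bidual_embed x + u|.
  (* Three errors: [|x - z|] occurs twice, and the tolerance of the stage once. *)
  apply/ler_addgt0Pr => e e0; have e3 : 0 < e / 3 by rewrite divr_gt0.
  have [z [xz Dz]] : ball x (e / 3) `&` D !=set0.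
    apply: Ddense; last exact: ball_open.
    by exists x; exact: ballxx.
  have [k _ kz] := ptsD z Dz.
  have [m me] : exists m : nat, m.+1%:R^-1 < e / 3.
    have [N _ NP] := near_infty_natSinv_lt (PosNum e3).
    by exists N; exact: (NP N (leqnn N)).
  have := ptu (pickle (k, m)); rewrite /pt /ep pickleK /= kz => zu.
  have zE : bidual_embed z + u = (bidual_embed x + u) + bidual_embed (z - x).
    apply/val_inj/funext => f.
    rewrite -[LHS]/((f z : R) + (u f : R)).
    rewrite -[RHS]/(((f x : R) + (u f : R)) + (f (z - x) : R)).
    have -> : (f (z - x) : R) = (f z : R) - (f x : R) by exact: linearB.
    by ring.
  have zxu : `|bidual_embed z + u| <= `|bidual_embed x + u| + `|z - x|.
    rewrite zE; apply: le_trans (ler_normD _ _) _.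
    by rewrite lerD2l; exact: bidual_embed_norm_le.
  have xlez : `|x| <= `|z| + `|x - z| by rewrite -{1}(subrKC z x) ler_normD.
  move: xz (le_trans zu zxu); rewrite -ball_normE /= (distrC z x) => xz.
  move: xlez me; move: (m.+1%:R^-1) `|_ + u| => r s; lra.
have additive x : `|bidual_embed x + u| = 1 + `|x|.
  apply/eqP; rewrite eq_le uge andbT addrC.
  by apply: le_trans (ler_normD _ _) _; apply: lerD => //;
    exact: bidual_embed_norm_le.
exists u => //; split; last by split.
(* The lower bound [uge] at [x = 0] puts [u] on the sphere. *)
apply/eqP; rewrite eq_le u1 /=.
have := uge 0; rewrite normr0 addr0 (_ : bidual_embed 0 = 0) ?add0r//.
by apply/val_inj/funext => f; rewrite -[LHS]/(f 0) linear0.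
Qed.
End daugavet.

Theorem theorem3p2 (R : realType) (X : completeNormedModType R)
    (X_separable : separable X) (X_neq0 : exists x : X, x != 0) :
  daugavet_property X <->
  (forall W : set (dual (dual X)),
     relatively_open (T := weak_star_topology (dual X))
       (unit_ball (dual (dual X))) W ->
     W !=set0 ->
     exists2 u : dual (dual X), (unit_sphere (dual (dual X)) `&` W) u &
       forall x : X, `|bidual_embed x + u| = 1 + `|x|).
Proof.
split=> [dX W oW W0|H x W e x1 [A oA ->] [w [w1 Aw]] e0].
  exact: daugavet_norm_additive.
have [L [d [d0 LA]]] := initial_ptws_basic_nbhs oA Aw.
have d2 : 0 < d / 2 by rewrite divr_gt0.
have e2 : 0 < e / 2 by rewrite divr_gt0.
(* [B] extends a weak neighbourhood of [w] to the bidual; the other half of [d] is spent on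
   approximating [u] from [X]. *)
pose B : set (weak_star_topology (dual X)) :=
  [set v | forall g, g \in L -> `|v g - g w| < d / 2].
have oB : open B.
  exact: (@initial_ptws_open_near _ _ _
    (fun v : dual (dual X) => (v : dual X -> R^o)) L (fun g => g w)).
have oW : relatively_open (T := weak_star_topology (dual X))
    (unit_ball (dual (dual X))) (unit_ball (dual (dual X)) `&` B) by exists B.
have [|u [_ [u1 Bu]] uadd] := H _ oW.
  exists (bidual_embed w); split.
    exact: le_trans (bidual_embed_norm_le w) w1.
  by move=> g gL; rewrite -[X in X - _]/(g w) subrr normr0.
have [f f1] := dual_norm_adherent (bidual_embed x + u) e2.
rewrite uadd x1 -[ltRHS]/((f x : R) + (u f : R)) => fxu.
have de : 0 < Num.min (d / 2) (e / 2) by rewrite lt_min d2.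
(* Closeness to [u] on [L] puts [y] in [W]; closeness at [f] gives [f (x + y) > 2 - e]. *)
have [y y1 yP] := goldstine (f :: L) u1 de.
exists y.
  split => //; apply: LA => g gL.
  have := yP g; rewrite in_cons gL orbT lt_min => /(_ isT)/andP[yu _].
  rewrite (splitr d) -[_ - _](subrKA (u g : R)).
  by apply: le_lt_trans (ler_normD _ _) _; rewrite ltrD// Bu.
apply: lt_le_trans (dual_unit_le (x + y) f1).
have := yP f; rewrite mem_head lt_min => /(_ isT)/andP[_].
rewrite ltr_norml => /andP[yu _].
have -> : (f (x + y) : R) = (f x : R) + (f y : R) by exact: linearD.
by lra.
Qed.
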